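(* Let $\varepsilon>0$ be arbitrarily small, and let $(q_n)_{n\in\mathbb{N}}$ be a real-valued sequence satisfying, for all sufficiently large $n\in\mathbb{N}$, the gap condition $$\frac{q_{n+1}}{q_n}>1+\frac{1}{n^{1-\varepsilon}} .$$ Then there exists $c_\varepsilon>0$ such that for every $0<c\leq c_\varepsilon$ and for Lebesgue-almost every $x\in[0,1)$ there exists $\delta_0\in[0,1)$ such that $$\|q_n x-\delta_0\|<\frac{c}{n}\qquad\text{for at most finitely many } n\geq 1 .$$
   Context: $\|y\|$ denotes the distance from $y\in\mathbb{R}$ to the nearest integer. The point $\delta_0$ may depend on $x$ (and on $c$). *)

(* Defs.v *)
From mathcomp Require Import all_boot all_order all_algebra.
From mathcomp Require Import all_classical all_reals all_analysis.
Set Implicit Arguments.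
Unset Strict Implicit.
Unset Printing Implicit Defensive.
Import Order.TTheory GRing.Theory Num.Theory.
Local Open Scope classical_set_scope.
Local Open Scope ring_scope.

Definition dist_int (R : realType) (y : R) : R :=
  inf [set `|y - k%:~R| | k in [set: int]].

(* Main.v *)
Require Import Defs.
From mathcomp Require Import all_boot all_order all_algebra.
From mathcomp Require Import all_classical all_reals all_analysis.
From mathcomp Require Import ring lra zify.
Set Implicit Arguments.
Unset Strict Implicit.
Unset Printing Implicit Defensive.
Import Order.TTheory GRing.Theory Num.Theory.

(** The point [delta0] is found by successively removing, from the circle, the
    arcs of radius [c / n] around the points [q n * x].  Suppose that the set
    left over from the indices below [N] has measure [m].  The next block of
    indices, from [N] to a constant multiple [B * N], carries arcs of total
    length about [2 * c * B], a small constant; if its points were independent of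
    the set already built, they would remove only a small proportion of it.  So,
    when [c] is small in terms of [B], at least half of the set should survive
    each block, and after [k] blocks the measure is at least [2 ^- k].

    The gap condition supplies the independence.  Over [N ^ (1 - eps)] indices,
    up to a small power of [N], the sequence grows by any prescribed power of [N],
    so two indices of the block at that distance give nearly independent points
    modulo 1, and points beyond the beginning of the block are nearly independent
    of the past.  Hence the length removed by a block has mean at most [m / 4] and
    variance at most a power [N ^- eta] times [m], and Chebyshev's inequality
    bounds by [2 ^- k], up to a constant, the probability in [x] that the block
    removes more than half.  For this to work [2 ^ k] has to be a small power of
    [N], and so the blocks are [2 ^ (P * k) <= n < 2 ^ (P * k.+1)] with a fixed
    [P >= 4 / eps]; this is why [c] depends on [eps].  The probabilities being
    summable, almost every [x] admits a starting level [K] from which no block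
    ever removes more than half.  The sets left over are then nonempty forever,
    and a limit of points taken from them gives [delta0].

    Everything but the last step is finite counting.  The circle is cut at level
    [k] into [8 * 2 ^ (P * k)] intervals, and an interval survives when its parent
    does and no point of the block comes close to it ([alive]).  The variable [x]
    is replaced by the corner of the cell of width [(Q k)^-1] containing it, with
    [Q k] so large that the points of the block hardly move.  Within a cell of
    level [k] the cells of level [k.+1] form an arithmetic progression, so all
    probabilities are counts of terms [th + a * j] modulo 1 lying in an interval.
    A telescoping identity for sums of floors gives those counts
    ([hit_sum_le], [hit_sum_ge]), a division into blocks gives the pair counts
    ([hit_pair_le]), and these yield the variance ([variance_le]) and the rarity of
    bad cells ([few_bad_steps], [few_bad_children]).  The gap condition enters in
    [q_far] and [step_ok_eventually], the limit point is built in [target_exists],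
    and the measure estimate is [bad_negligible]. *)

Local Open Scope ring_scope.

(** * Counting the points of an arithmetic progression modulo 1 *)

Section Counting.
Variable R : realType.
Implicit Types (y th al l e : R).

(** Membership of [y] modulo 1 in the interval [0, l). *)
Definition hit (l y : R) : bool := y - (Num.floor y)%:~R < l.

(** The indicator is a difference of floors, which makes its sums along a
    progression telescope. *)
Lemma hit_floor l y : 0 <= l <= 1 ->
  (hit l y)%:R = (Num.floor y)%:~R - (Num.floor (y - l))%:~R :> R.
Proof.
move=> /andP[l0 l1]; have /andP[fy1 fy2] := floor_itv y.
rewrite /hit; case: ltP => hl.
  have -> : Num.floor (y - l) = Num.floor y - 1.
    by apply: floor_def; rewrite subrK rmorphB /=; move: fy2; rewrite rmorphD /=; lra.
  by rewrite rmorphB /=; lra.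
have -> : Num.floor (y - l) = Num.floor y; last by rewrite subrr.
by apply: floor_def; move: fy2; rewrite rmorphD /=; lra.
Qed.

Definition floor_sum (M : nat) al th : R :=
  \sum_(0 <= j < M) (Num.floor (th + al * j%:R))%:~R.

(** Shifting the origin by one step only changes the two ends of the
    progression. *)
Lemma floor_sum_shift M al th :
  al * M%:R - 1 <= floor_sum M al (th + al) - floor_sum M al th <= al * M%:R + 1.
Proof.
rewrite /floor_sum -sumrB (@telescope_sumr_eq _ _ _
  (fun j => (Num.floor (th + al * j%:R))%:~R)) //; last first.
  by move=> k _; rewrite -natr1 mulrDr mulr1 (addrAC th al) addrA.
rewrite mulr0 addr0.
have := floor_itv th; have := floor_itv (th + al * M%:R).
by rewrite !rmorphD /= => /andP[? ?] /andP[? ?]; lra.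
Qed.

Lemma floor_sum_shiftn M al th s :
  s%:R * (al * M%:R - 1) <= floor_sum M al (th + al * s%:R) - floor_sum M al th
    <= s%:R * (al * M%:R + 1).
Proof.
elim: s => [|s /andP[IH1 IH2]]; first by rewrite !mul0r mulr0 addr0 subrr lexx.
have /andP[] := floor_sum_shift M al (th + al * s%:R).
have -> : th + al * s%:R + al = th + al * s.+1%:R by rewrite -natr1; ring.
by rewrite -natr1; lra.
Qed.

Lemma floor_sum_le M al th th' : th <= th' -> floor_sum M al th <= floor_sum M al th'.
Proof.
by move=> h; apply: ler_sum => j _; rewrite ler_int; apply: le_floor; rewrite lerD2r.
Qed.

Lemma hit_sumE M al l th : 0 <= l <= 1 ->
  \sum_(0 <= j < M) (hit l (th + al * j%:R))%:R =
  floor_sum M al th - floor_sum M al (th - l).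
Proof.
move=> l01; rewrite /floor_sum -sumrB; apply: eq_bigr => j _.
by rewrite hit_floor // (addrAC th).
Qed.

(** The interval of length [l] lies between consecutive multiples of the step,
    so the difference of floor sums is controlled by [l / al] shifts by one step,
    each worth [al * M] up to 1. *)
Lemma hit_sum_le M al l th : 0 < al -> 0 <= l <= 1 ->
  \sum_(0 <= j < M) (hit l (th + al * j%:R))%:R <= (l / al + 1) * (al * M%:R + 1).
Proof.
move=> al0 l01; rewrite hit_sumE //.
have la0 : 0 <= l / al by case/andP: l01 => ? _; rewrite divr_ge0 // ltW.
have /andP[s1 s2] := truncn_itv la0; set s := Num.truncn _ in s1 s2.
have /andP[_ h] := floor_sum_shiftn M al (th - l) s.+1.
have hle : th <= th - l + al * s.+1%:R.
  by move: s2; rewrite ltr_pdivrMr // (mulrC _ al); lra.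
have := floor_sum_le M al hle.
have : s.+1%:R * (al * M%:R + 1) <= (l / al + 1) * (al * M%:R + 1).
  have v0 : 0 <= al * M%:R by rewrite mulr_ge0 // ltW.
  by rewrite ler_wpM2r ?addr_ge0 //; move: s1; rewrite -natr1; lra.
lra.
Qed.

Lemma hit_sum_ge M al l th : 0 < al -> 0 <= l <= 1 ->
  l * M%:R - l / al - al * M%:R <= \sum_(0 <= j < M) (hit l (th + al * j%:R))%:R.
Proof.
move=> al0 l01; rewrite hit_sumE //.
have la0 : 0 <= l / al by case/andP: l01 => ? _; rewrite divr_ge0 // ltW.
have /andP[s1 s2] := truncn_itv la0; set s := Num.truncn _ in s1 s2.
have /andP[h _] := floor_sum_shiftn M al (th - l) s.
have hle : th - l + al * s%:R <= th.
  by move: s1; rewrite ler_pdivlMr // (mulrC _ al); lra.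
have := floor_sum_le M al hle.
suff : l * M%:R - l / al - al * M%:R <= s%:R * (al * M%:R - 1) by lra.
have E : l * M%:R = (l / al) * (al * M%:R) by field; rewrite gt_eqF.
rewrite E; move: s2; rewrite -natr1; set u := l / al in s1 la0 *; set v := al * M%:R => s2.
have v0 : 0 <= v by rewrite mulr_ge0 // ltW.
have [v1|v1] := lerP 1 v; nra.
Qed.

End Counting.

(** * Two progressions with well separated steps are nearly independent *)

Section Pairs.
Variable R : realType.
Implicit Types (y th al l e : R).

Lemma big_nat_blocks (F : nat -> R) (B T : nat) :
  \sum_(0 <= j < B * T) F j =
  \sum_(0 <= i < B) \sum_(0 <= s < T) F (i * T + s)%N.
Proof.
elim: B => [|B IH]; first by rewrite mul0n !big_geq.
rewrite big_nat_recr //= -IH (@big_cat_nat _ _ _ (B * T)) //=; last first.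
  by rewrite leq_mul2r leqnSn orbT.
congr (_ + _); rewrite -{1}[(B * T)%N]add0n big_addn mulSn addnK.
by apply: eq_bigr => s _; rewrite addnC.
Qed.

(** A slowly moving point that hits an interval somewhere in a block of indices
    hits a slightly larger interval at the end of the block. *)
Lemma hit_enlarge l th d s : 0 <= d -> d <= s -> l + s <= 1 ->
  hit l (th + d) -> hit (l + s) (th + s).
Proof.
move=> d0 ds ls; rewrite /hit => h.
have /andP[f1 f2] := floor_itv (th + d).
have -> : Num.floor (th + s) = Num.floor (th + d); last by lra.
by apply: floor_def; move: f1 f2; rewrite !rmorphD /=; lra.
Qed.

(** Over a block of [T] indices the slow progression barely moves, while the fast
    one is already equidistributed.  The slow condition is therefore replaced by a
    condition on the block as a whole, and the two counts multiply.  The second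
    factor counts the hit blocks among [B], as a progression of step
    [al * T]. *)
Lemma hit_pair_block M B T l l' al al' th th' :
  0 < al -> 0 < al' -> (0 < T)%N -> (M <= B * T)%N ->
  0 <= l -> l + al * T%:R <= 1 -> 0 <= l' <= 1 ->
  \sum_(0 <= j < M) (hit l (th + al * j%:R))%:R * (hit l' (th' + al' * j%:R))%:R
  <= ((l' / al' + 1) * (al' * T%:R + 1)) *
     (((l + al * T%:R) / (al * T%:R) + 1) * (al * T%:R * B%:R + 1)).
Proof.
move=> al0 al'0 T0 MBT l0 lT l'01.
have alT0 : 0 < al * T%:R by rewrite mulr_gt0 // ltr0n.
set C1 := (l' / al' + 1) * _.
have C10 : 0 <= C1.
  have /andP[l'0 _] := l'01; rewrite /C1 mulr_ge0 // addr_ge0 //.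
    by rewrite divr_ge0 // ltW.
  by rewrite mulr_ge0 // ltW.
apply: (@le_trans _ _ (\sum_(0 <= j < B * T)
   ((hit l (th + al * j%:R))%:R * (hit l' (th' + al' * j%:R))%:R))).
  rewrite (@big_cat_nat _ _ _ M 0 (B * T)) //= lerDl.
  by apply: sumr_ge0 => j _; rewrite mulr_ge0.
rewrite big_nat_blocks.
apply: (@le_trans _ _ (\sum_(0 <= i < B)
   C1 * (hit (l + al * T%:R) (th + al * T%:R + al * T%:R * i%:R))%:R)).
  apply: ler_sum => i _.
  have E x a s : x + a * (i * T + s)%:R = x + a * (i * T)%:R + a * s%:R :> R.
    by rewrite natrD mulrDr addrA.
  case hi : (hit (l + al * T%:R) _); last first.
    rewrite mulr0 big1_seq // => s; rewrite mem_index_iota => /andP[_ /andP[_ sT]].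
    case hs : (hit l _); last by rewrite mul0r.
    rewrite E in hs; move: hi.
    have -> : th + al * T%:R + al * T%:R * i%:R = th + al * (i * T)%:R + al * T%:R.
      by rewrite natrM; ring.
    rewrite (hit_enlarge _ _ lT hs) //; first by rewrite mulr_ge0 // ltW.
    by rewrite ler_wpM2l ?ltW // ltr_nat.
  rewrite mulr1; apply: le_trans (hit_sum_le T (th' + al' * (i * T)%:R) al'0 l'01).
  by apply: ler_sum => s _; rewrite !E; case: (hit l _); rewrite ?mul1r ?mul0r.
rewrite -mulr_sumr ler_wpM2l //; apply: hit_sum_le => //.
by rewrite lT andbT addr_ge0 // ltW.
Qed.

(** The block length is chosen so that [al * T] is about [e * l / 10]: over a
    block the slow progression moves little compared with the interval, while the
    fast one winds many times around the circle. *)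
Lemma hit_pair_le M l al al' th th' e :
  0 < e <= 1 -> 0 < l <= 1 / 2 -> 0 < al -> 0 < al' ->
  200 * al <= e ^+ 2 * l ^+ 2 -> 200 * al' <= e ^+ 2 * l ^+ 2 ->
  10 <= e * (al * M%:R) -> 200 * al <= al' * (e ^+ 2 * l) ->
  \sum_(0 <= j < M) (hit l (th + al * j%:R))%:R * (hit l (th' + al' * j%:R))%:R
  <= l ^+ 2 * M%:R * (1 + 3 * e).
Proof.
move=> /andP[e0 e1] /andP[l0 l1] al0 al'0 hal hal' hM hr.
pose sg := e * l / 10.
have sg0 : 0 < sg by rewrite /sg divr_gt0 ?mulr_gt0.
have el1 : e * l <= 1 by nra.
have el0 : 0 < e * l by rewrite mulr_gt0.
have al_sg : 2 * al <= sg by rewrite /sg; nra.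
have sa0 : 0 <= sg / al by rewrite divr_ge0 // ltW.
have /andP[T1 T2] := truncn_itv sa0; set T := Num.truncn _ in T1 T2.
have sa2 : 2 <= sg / al by rewrite ler_pdivlMr.
have T0 : (0 < T)%N by rewrite truncn_gt0; lra.
have Tge : sg / al <= 2 * T%:R by move: T2; rewrite -natr1; lra.
have Tr0 : 0 < T%:R :> R by rewrite ltr0n.
have alT : al * T%:R <= sg by move: T1; rewrite ler_pdivlMr // mulrC.
have alT2 : sg <= 2 * (al * T%:R).
  by move: Tge; rewrite ler_pdivrMr //; lra.
pose B := (M %/ T).+1.
have MB : (M <= B * T)%N by rewrite ltnW // ltn_ceil.
have BT : B%:R * T%:R <= M%:R + T%:R :> R.
  by rewrite -natrM -natrD ler_nat mulSn addnC leq_add2r leq_trunc_div.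
have lT : l + al * T%:R <= 1 by rewrite /sg in alT; lra.
apply: le_trans (hit_pair_block th th' al0 al'0 T0 MB (ltW l0) lT _) _.
  by apply/andP; split; lra.
set s := al * T%:R in alT alT2 lT *.
have s0 : 0 < s by rewrite mulr_gt0.
have M0 : 0 < M%:R :> R.
  by rewrite lt_neqAle ler0n andbT eq_sym; apply/eqP => M0; move: hM; rewrite M0; lra.
have sl : s <= l * (e / 10) by rewrite /sg in alT; lra.
have aM0 : 0 < al * M%:R by rewrite mulr_gt0.
(* Dividing the first factor by [T] and multiplying the second by [T] turns them
   into a density of hits inside a block and a number of indices lying in hit
   blocks, each close to its ideal value [l] and [l * M]. *)
have -> : (l / al' + 1) * (al' * T%:R + 1) * (((l + s) / s + 1) * (s * B%:R + 1))
  = (l + al' + l / (al' * T%:R) + T%:R^-1) *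
    ((l + 2 * s) * ((B%:R * T%:R) + T%:R / s)).
  by rewrite /s; field; rewrite !gt_eqF.
have F1 : l + al' + l / (al' * T%:R) + T%:R^-1 <= l * (1 + e / 2).
  have h1 : al' <= l * (e / 10) by nra.
  have h2 : l / (al' * T%:R) <= l * (e / 10).
    rewrite ler_pM2l // -[_^-1]mul1r ler_pdivrMr ?mulr_gt0 //.
    rewrite /sg in alT2; rewrite -(ler_pM2l al0).
    have -> : al * (e / 10 * (al' * T%:R)) = e / 10 * (al' * s) by rewrite /s; ring.
    have : e / 10 * (al' * (e * l / 20)) <= e / 10 * (al' * s).
      by rewrite !ler_pM2l ?divr_gt0 //; lra.
    by lra.
  have h3 : T%:R^-1 <= l * (e / 10).
    rewrite -[_^-1]mul1r ler_pdivrMr //.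
    rewrite /sg in alT2; rewrite -(ler_pM2l al0).
    have -> : al * (l * (e / 10) * T%:R) = l * (e / 10) * s by rewrite /s; ring.
    have : l * (e / 10) * (e * l / 20) <= l * (e / 10) * s.
      by rewrite ler_pM2l ?mulr_gt0 ?divr_gt0 //; lra.
    by lra.
  by lra.
have F2 : (l + 2 * s) * (B%:R * T%:R + T%:R / s) <= l * M%:R * (1 + e / 2).
  have h1 : l + 2 * s <= l * (1 + e / 5) by lra.
  have h2 : B%:R * T%:R + T%:R / s <= M%:R * (1 + e / 5).
    have -> : T%:R / s = al^-1 by rewrite /s; field; rewrite !gt_eqF.
    have h3 : al^-1 <= M%:R * (e / 10).
      by rewrite -[_^-1]mul1r ler_pdivrMr //; lra.
    have h4 : T%:R <= al^-1 by rewrite -(ler_pM2l al0) divff ?gt_eqF // -/s; rewrite /sg in alT; lra.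
    by lra.
  apply: le_trans (_ : (l * (1 + e / 5)) * (M%:R * (1 + e / 5)) <= _).
    by rewrite ler_pM // ?addr_ge0 ?mulr_ge0 ?invr_ge0 ?ltW.
  have -> : (l * (1 + e / 5)) * (M%:R * (1 + e / 5)) = l * M%:R * ((1 + e / 5) * (1 + e / 5)) by ring.
  by rewrite ler_pM2l ?mulr_gt0 //; nra.
apply: le_trans (_ : l * (1 + e / 2) * (l * M%:R * (1 + e / 2)) <= _).
  apply: ler_pM => //.
    by rewrite !addr_ge0 // ?divr_ge0 ?mulr_ge0 ?invr_ge0 ?ltW.
  by rewrite mulr_ge0 ?addr_ge0 ?divr_ge0 ?mulr_ge0 // ltW.
have -> : l * (1 + e / 2) * (l * M%:R * (1 + e / 2)) = l ^+ 2 * M%:R * ((1 + e / 2) * (1 + e / 2)) by ring.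
by rewrite ler_pM2l ?mulr_gt0 ?exprn_gt0 //; nra.
Qed.

End Pairs.

(** * Second moment of the number of hits *)

Section SecondMoment.
Variable R : realType.
Implicit Types (y e : R) (M J : nat).

Definition hits M (W : {set 'I_M}) y : R :=
  \sum_(i in W) (hit (2 / M%:R) (y - i%:R / M%:R))%:R.

Lemma hits_ge0 M (W : {set 'I_M}) y : 0 <= hits W y.
Proof. by apply: sumr_ge0. Qed.

(** The left ends [i / M] themselves form a progression of step [1 / M], so the
    general count bounds the overlap. *)
Lemma hits_le6 M (W : {set 'I_M}) y : (1 < M)%N -> hits W y <= 6.
Proof.
move=> M1; have M0 : 0 < M%:R :> R by rewrite ltr0n; lia.
apply: (@le_trans _ _ (\sum_(i < M) (hit (2 / M%:R) (y - i%:R / M%:R))%:R)).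
  by rewrite [leRHS](bigID (mem W)) /= lerDl sumr_ge0.
rewrite (reindex_inj rev_ord_inj) /=.
rewrite (eq_bigr (fun i : 'I_M => (hit (2 / M%:R)
   (y - 1 + M%:R^-1 + M%:R^-1 * i%:R))%:R)); last first.
  move=> i _; rewrite natrB // -natr1; congr (hit _ _)%:R.
  by field; rewrite gt_eqF.
rewrite -(big_mkord xpredT (fun i => (hit _ (_ + _ * i%:R))%:R)).
apply: le_trans (hit_sum_le _ _ _ _) _; rewrite ?invr_gt0 //.
  by rewrite divr_ge0 //= ler_pdivrMr // mul1r (ler_nat _ 2).
by rewrite invrK divfK ?gt_eqF // mulVf ?gt_eqF //; lra.
Qed.

(** The step [a] is small compared with [l ^+ 2], and [J] steps wind around the
    circle at least [10 / e] times: this is what makes [J] terms equidistributed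
    at scale [l] with relative error [e]. *)
Definition fine_step l e J (a : R) :=
  [/\ 0 < a, 200 * a <= e ^+ 2 * l ^+ 2 & 10 <= e * (a * J%:R)].

Section Sums.
Variables (M J : nat) (W : {set 'I_M}) (e : R).
Hypotheses (e01 : 0 < e <= 1) (M4 : (4 <= M)%N).
Variable l : R.
Hypothesis lE : l = 2 / M%:R.

Let M0 : 0 < M%:R :> R. Proof. by rewrite ltr0n; lia. Qed.
Let l0 : 0 < l. Proof. by rewrite lE divr_gt0. Qed.
Let lhalf : l <= 1 / 2.
Proof.
have M4R : 4 <= M%:R :> R by rewrite (ler_nat _ 4).
by rewrite lE ler_pdivrMr //; lra.
Qed.

Lemma fine_error a : fine_step l e J a -> l / a + a * J%:R + 1 <= l * J%:R * e.
Proof.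
case=> a0 h1 h2; move: e01 => /andP[e0 e1].
have h3 : l / a <= l * (J%:R * (e / 10)).
  rewrite ler_pM2l // -[_^-1]mul1r ler_pdivrMr //. by lra.
have aJ0 : 0 < a * J%:R by nra.
have J0 : 0 < J%:R :> R by rewrite -(pmulr_rgt0 _ a0).
have h4 : a <= l * (e / 10).
  have el1 : e * l <= 1.
    apply: (@le_trans _ _ (1 * 1)); last by lra.
    by apply: ler_pM; have := l0; have := lhalf; lra.
  have el0 : 0 < e * l by rewrite mulr_gt0.
  have -> : l * (e / 10) = e * l / 10 by ring.
  move: h1; have -> : e ^+ 2 * l ^+ 2 = (e * l) * (e * l) by ring.
  move: el0 el1; move: (e * l) => x x0 x1 h.
  by have : 0 <= x * (1 - x) by [apply: mulr_ge0; lra]; lra.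
have h5 : a * J%:R <= l * (e / 10) * J%:R by rewrite ler_pM2r.
have h6 : 1 <= a * J%:R by nra.
by lra.
Qed.

Lemma hit_sum_bounds a th : fine_step l e J a ->
  l * J%:R * (1 - e) <= \sum_(0 <= j < J) (hit l (th + a * j%:R))%:R <= l * J%:R * (1 + e).
Proof.
move=> ha; have := fine_error ha; case: ha => a0 h1 h2 err.
have l01 : 0 <= l <= 1 by apply/andP; split; [exact: ltW | have := lhalf; lra].
have := hit_sum_le J th a0 l01; have := hit_sum_ge J th a0 l01.
have -> : (l / a + 1) * (a * J%:R + 1) = l * J%:R + l / a + a * J%:R + 1.
  by field; rewrite gt_eqF.
by lra.
Qed.

Lemma hits_sumE a th :
  \sum_(0 <= j < J) hits W (th + a * j%:R) =
  \sum_(i in W) \sum_(0 <= j < J) (hit l (th - i%:R / M%:R + a * j%:R))%:R.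
Proof.
rewrite exchange_big /=; apply: eq_bigr => i _; apply: eq_bigr => j _.
by rewrite addrAC lE.
Qed.

Lemma hits_sum_bounds a th : fine_step l e J a ->
  #|W|%:R * l * J%:R * (1 - e) <= \sum_(0 <= j < J) hits W (th + a * j%:R)
   <= #|W|%:R * l * J%:R * (1 + e).
Proof.
move=> ha; rewrite hits_sumE -!(mulrA #|W|%:R) !mulr_natl -!sumr_const.
by apply/andP; split; apply: ler_sum => i _;
  have /andP[? ?] := hit_sum_bounds (th - i%:R / M%:R) ha.
Qed.

Lemma hits_pair_le a a' th th' : fine_step l e J a -> fine_step l e J a' ->
  200 * a <= a' * (e ^+ 2 * l) ->
  \sum_(0 <= j < J) hits W (th + a * j%:R) * hits W (th' + a' * j%:R)
   <= #|W|%:R ^+ 2 * l ^+ 2 * J%:R * (1 + 3 * e).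
Proof.
move=> [a0 h1 h2] [a'0 h1' h2'] haa'.
have -> : \sum_(0 <= j < J) hits W (th + a * j%:R) * hits W (th' + a' * j%:R) =
  \sum_(i in W) \sum_(i' in W) \sum_(0 <= j < J)
    (hit l (th - i%:R / M%:R + a * j%:R))%:R *
    (hit l (th' - i'%:R / M%:R + a' * j%:R))%:R.
  transitivity (\sum_(0 <= j < J) \sum_(i in W) \sum_(i' in W)
    ((hit l (th - i%:R / M%:R + a * j%:R))%:R : R) *
    (hit l (th' - i'%:R / M%:R + a' * j%:R))%:R).
    apply: eq_bigr => j _; rewrite /hits mulr_suml; apply: eq_bigr => i _.
    rewrite mulr_sumr; apply: eq_bigr => i' _.
    by rewrite (addrAC th) (addrAC th') lE.
  by rewrite exchange_big /=; apply: eq_bigr => i _; rewrite exchange_big.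
have -> : #|W|%:R ^+ 2 * l ^+ 2 * J%:R * (1 + 3 * e) =
    \sum_(i in W) \sum_(i' in W) (l ^+ 2 * J%:R * (1 + 3 * e)).
  by rewrite !sumr_const -mulrnA -[RHS]mulr_natl natrM; ring.
apply: ler_sum => i _; apply: ler_sum => i' _.
by apply: hit_pair_le => //; rewrite l0 lhalf.
Qed.

Lemma near_sum_le n w H :
  \sum_(0 <= m < w) ((n < m + H) && (m < n + H))%N%:R <= 2 * H%:R :> R.
Proof.
rewrite -natr_sum -natrM ler_nat.
rewrite (eq_bigr (fun m => if (n < m + H) && (m < n + H) then 1 else 0)%N); last first.
  by move=> m _; case: ifP.
rewrite -big_mkcond sum1_count -size_filter -[leqRHS](size_iota (n.+1 - H)).
apply: uniq_leq_size; first by rewrite filter_uniq // iota_uniq.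
by move=> m; rewrite mem_filter !mem_iota; lia.
Qed.

Section Variance.
Variables (w H : nat) (th al : nat -> R).
Hypothesis al_fine : forall n, (n < w)%N -> fine_step l e J (al n).
Hypothesis al_far : forall n m, (n + H <= m)%N -> (m < w)%N ->
  200 * al n <= al m * (e ^+ 2 * l).

Let mu : R := w%:R * #|W|%:R * l.
Let X (n j : nat) := hits W (th n + al n * j%:R).

(** Pairs of indices closer than [H] are not decorrelated; for them one of the two
    numbers of hits is replaced by its absolute bound 6. *)
Lemma sum_pair_le n m : (n < w)%N -> (m < w)%N ->
  \sum_(0 <= j < J) X n j * X m j <=
  ((n < m + H) && (m < n + H))%N%:R * (12 * #|W|%:R * l * J%:R)
  + #|W|%:R ^+ 2 * l ^+ 2 * J%:R * (1 + 3 * e).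
Proof.
move=> nw mw; have /andP[e0 e1] := e01.
have pos : 0 <= #|W|%:R ^+ 2 * l ^+ 2 * J%:R * (1 + 3 * e).
  by rewrite !mulr_ge0 ?exprn_ge0 ?(ltW l0) ?addr_ge0 ?mulr_ge0 // ltW.
case: (boolP ((n < m + H) && (m < n + H))%N) => [near|]; last first.
  rewrite mul0r add0r negb_and -!leqNgt => /orP[far|far].
    rewrite (eq_bigr (fun j => X m j * X n j)); last by move=> j _; rewrite mulrC.
    by apply: hits_pair_le; [exact: al_fine| exact: al_fine| exact: al_far].
  by apply: hits_pair_le; [exact: al_fine| exact: al_fine| exact: al_far].
rewrite mul1r; apply: ler_wpDr => //.
apply: (@le_trans _ _ (\sum_(0 <= j < J) X n j * 6)).
  apply: ler_sum => j _; rewrite ler_wpM2l ?hits_ge0 //; apply: hits_le6; exact: ltn_trans M4.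
rewrite -mulr_suml.
have /andP[_ h] := hits_sum_bounds (th n) (al_fine nw).
have h0 : 0 <= #|W|%:R * l * J%:R by rewrite !mulr_ge0 // ltW.
have h1 : #|W|%:R * l * J%:R * (1 + e) <= #|W|%:R * l * J%:R * 2.
  by rewrite ler_wpM2l //; lra.
by rewrite /X; lra.
Qed.

(** The far pairs reproduce the square of the mean up to the relative error [e],
    and there are only about [2 * H * w] near pairs. *)
Lemma variance_le :
  \sum_(0 <= j < J) (\sum_(0 <= n < w) X n j - mu) ^+ 2 <=
  J%:R * (24 * H%:R * mu + 5 * e * mu ^+ 2).
Proof.
have /andP[e0 e1] := e01.
have mu0 : 0 <= mu by rewrite !mulr_ge0 // ltW.
have S1 : mu * J%:R * (1 - e) <= \sum_(0 <= j < J) \sum_(0 <= n < w) X n j.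
  rewrite exchange_big /=.
  have -> : mu * J%:R * (1 - e) = \sum_(0 <= n < w) (#|W|%:R * l * J%:R * (1 - e)).
    by rewrite sumr_const_nat subn0 -mulr_natl /mu; ring.
  apply: ler_sum_nat => n /andP[_ nw].
  by have /andP[] := hits_sum_bounds (th n) (al_fine nw).
have S2 : \sum_(0 <= j < J) (\sum_(0 <= n < w) X n j) ^+ 2 <=
    J%:R * (24 * H%:R * mu + mu ^+ 2 * (1 + 3 * e)).
  have -> : \sum_(0 <= j < J) (\sum_(0 <= n < w) X n j) ^+ 2 =
     \sum_(0 <= n < w) \sum_(0 <= m < w) \sum_(0 <= j < J) X n j * X m j.
    transitivity (\sum_(0 <= j < J) \sum_(0 <= n < w) \sum_(0 <= m < w) X n j * X m j).
      by apply: eq_bigr => j _; rewrite expr2 mulr_suml; apply: eq_bigr => n _; rewrite mulr_sumr.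
    by rewrite exchange_big /=; apply: eq_bigr => n _; rewrite exchange_big.
  apply: (@le_trans _ _ (\sum_(0 <= n < w)
     (2 * H%:R * (12 * #|W|%:R * l * J%:R)
      + w%:R * (#|W|%:R ^+ 2 * l ^+ 2 * J%:R * (1 + 3 * e))))).
    apply: ler_sum_nat => n /andP[_ nw].
    apply: (@le_trans _ _ (\sum_(0 <= m < w)
      (((n < m + H) && (m < n + H))%N%:R * (12 * #|W|%:R * l * J%:R)
       + #|W|%:R ^+ 2 * l ^+ 2 * J%:R * (1 + 3 * e)))).
      by apply: ler_sum_nat => m /andP[_ mw]; exact: sum_pair_le.
    rewrite big_split /= sumr_const_nat subn0 -[X in _ + X <= _]mulr_natl lerD2r.
    rewrite -mulr_suml ler_wpM2r ?near_sum_le //.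
    by rewrite !mulr_ge0 // ltW.
  rewrite sumr_const_nat subn0 -[leLHS]mulr_natl /mu.
  by rewrite le_eqVlt; apply/orP; left; apply/eqP; ring.
have -> : \sum_(0 <= j < J) (\sum_(0 <= n < w) X n j - mu) ^+ 2 =
  \sum_(0 <= j < J) (\sum_(0 <= n < w) X n j) ^+ 2
  - 2 * mu * \sum_(0 <= j < J) \sum_(0 <= n < w) X n j + J%:R * mu ^+ 2.
  have -> : J%:R * mu ^+ 2 = \sum_(0 <= j < J) mu ^+ 2.
    by rewrite sumr_const_nat subn0 mulr_natl.
  rewrite mulr_sumr -sumrB -big_split /=; apply: eq_bigr => j _; ring.
have : 2 * mu * (mu * J%:R * (1 - e)) <=
  2 * mu * \sum_(0 <= j < J) \sum_(0 <= n < w) X n j.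
  by rewrite ler_wpM2l // mulr_ge0.
by move: S2; lra.
Qed.

End Variance.
End Sums.

Lemma chebyshev_count J (X : nat -> R) (mu D V : R) : 0 < D ->
  \sum_(0 <= j < J) (X j - mu) ^+ 2 <= V ->
  D ^+ 2 * #|[set j : 'I_J | mu + D < X j]%SET|%:R <= V.
Proof.
move=> D0; apply: le_trans; rewrite big_mkord mulrC mulr_natl -sumr_const.
rewrite [leRHS](bigID [pred j in [set j : 'I_J | mu + D < X j]%SET]) /=.
apply: ler_wpDr; first by apply: sumr_ge0 => j _; rewrite sqr_ge0.
apply: ler_sum => j; rewrite inE => h.
by rewrite ler_pXn2r ?nnegrE //; lra.
Qed.

(** The mean of the number of hits is at most a quarter of [#|W|], and the first
    [H] indices, at 6 hits each, contribute at most an eighth.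
    Exceeding half of [#|W|] thus forces a deviation of an eighth, which
    Chebyshev's inequality makes rare because [H] is at most [e * #|W|] up to a
    constant. *)
Lemma few_bad_steps M J (W : {set 'I_M}) (e : R) (w H : nat) (th al : nat -> R) :
  0 < e <= 1 -> (4 <= M)%N -> (0 < #|W|)%N ->
  8 * (H + w)%:R <= M%:R :> R -> 384 * H%:R <= e * #|W|%:R ->
  (forall n, (H <= n < H + w)%N -> fine_step (2 / M%:R) e J (al n)) ->
  (forall n m, (H <= n)%N -> (n + H <= m)%N -> (m < H + w)%N ->
     200 * al n <= al m * (e ^+ 2 * (2 / M%:R))) ->
  #|[set j : 'I_J | #|W|%:R / 2 <
      \sum_(0 <= n < H + w) hits W (th n + al n * j%:R)]%SET|%:R <= 21 * e * J%:R :> R.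
Proof.
move=> e01 M4 W0 hw hH fine far; have /andP[e0 e1] := e01.
set V : R := #|W|%:R in hH *.
have V0 : 0 < V by rewrite ltr0n.
have M0 : 0 < M%:R :> R by rewrite ltr0n; lia.
pose X (j : nat) := \sum_(0 <= n < w) hits W (th (H + n)%N + al (H + n)%N * j%:R).
pose mu : R := w%:R * V * (2 / M%:R).
have mu0 : 0 <= mu by rewrite !mulr_ge0 ?invr_ge0.
have muV : mu <= V / 4.
  rewrite /mu -mulrA (mulrC w%:R) -mulrA ler_pM2l // mulrAC ler_pdivrMr //.
  by move: hw; rewrite natrD; have : 0 <= H%:R :> R by []; lra.
have var : \sum_(0 <= j < J) (X j - mu) ^+ 2 <=
    J%:R * (24 * H%:R * mu + 5 * e * mu ^+ 2).
  apply: (@variance_le M J W e e01 M4 _ erefl w H (fun n => th (H + n)%N)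
    (fun n => al (H + n)%N)); first by move=> n nw; apply: fine; clear -nw; lia.
  by move=> n m nm mw; apply: far; clear -nm mw; lia.
have D0 : 0 < V / 8 by rewrite divr_gt0.
have := chebyshev_count D0 var.
set S := [set j : 'I_J | mu + V / 8 < X j]%SET.
set S' := [set j : 'I_J | V / 2 < \sum_(0 <= n < H + w) hits W (th n + al n * j%:R)]%SET.
have SS' : S' \subset S.
  apply/fintype.subsetP => j; rewrite !inE.
  rewrite (@big_cat_nat _ _ _ H) //=; last exact: leq_addr.
  rewrite -{2}[H]add0n big_addn addnC addnK => h.
  have : \sum_(0 <= n < H) hits W (th n + al n * j%:R) <= H%:R * 6.
    rewrite mulr_natl -{2}(subn0 H) -sumr_const_nat.
    by apply: ler_sum => n _; apply: hits_le6; exact: ltn_trans M4.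
  have EX : X j = \sum_(0 <= n < w) hits W (th (n + H)%N + al (n + H)%N * j%:R).
    by apply: eq_bigr => n _; rewrite addnC.
  have : e * V <= V by rewrite ler_piMl // ltW.
  by rewrite EX; lra.
move=> hS; apply: (@le_trans _ _ #|S|%:R); first by rewrite ler_nat subset_leq_card.
have J0 : 0 <= J%:R :> R by [].
have V2 : 0 < V ^+ 2 / 64 by rewrite divr_gt0 // exprn_gt0.
rewrite -(ler_pM2l V2).
have h1 : H%:R * mu <= e * V ^+ 2 / 1536.
  apply: (@le_trans _ _ (e * V / 384 * (V / 4))); last by rewrite le_eqVlt; apply/orP; left; apply/eqP; field.
  by apply: ler_pM => //; lra.
have h2 : e * mu ^+ 2 <= e * (V ^+ 2 / 16).
  rewrite ler_pM2l //; have -> : V ^+ 2 / 16 = (V / 4) ^+ 2 by field.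
  by rewrite ler_pXn2r ?nnegrE //; lra.
have h3 : J%:R * (24 * H%:R * mu + 5 * e * mu ^+ 2) <=
  J%:R * (24 * (e * V ^+ 2 / 1536) + 5 * (e * (V ^+ 2 / 16))).
  by rewrite ler_wpM2l //; lra.
have h4 : 0 <= e * J%:R * V ^+ 2 by rewrite !mulr_ge0 ?exprn_ge0 // ltW.
have E : (V / 8) ^+ 2 = V ^+ 2 / 64 by field.
by move: hS; rewrite E; lra.
Qed.

End SecondMoment.

(** * The tree of surviving intervals *)

Lemma ltn_shift a b n : (n < b - a)%N -> (a <= a + n < b)%N.
Proof. lia. Qed.

(* [Q k] is the number of cells of level [k] in the variable [x], and each of them
   is divided into [r k] cells of level [k.+1]. *)
Section Process.
Variable R : realType.
Variables (P : nat) (q : nat -> R) (Q r : nat -> nat).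

Definition lev (k : nat) : nat := (2 ^ (P * k))%N.

(** The point of index [n] at the corner of the cell [a] of level [k].  The shift
    by half an interval makes the hit test of length two intervals symmetric
    around interval [i]. *)
Definition shifted_point k a n : R :=
  q n * a%:R / (Q k)%:R + (2 * (8 * lev k)%:R)^-1.

Definition avoids k a i n : bool :=
  ~~ hit (2 / (8 * lev k)%:R) (shifted_point k a n - i%:R / (8 * lev k)%:R).

(** Survival, in a process started at level [K] with all intervals, of the
    interval [i] of level [d + K] for the points computed from the cell [a].  It
    depends on [x] only through [a], so it is constant on cells. *)
Fixpoint alive (K d a i : nat) : bool :=
  if d is d'.+1 then
    alive K d' (a %/ r (d' + K)) (i %/ 2 ^ P) &&
    all (avoids (d' + K).+1 a i) (index_iota (lev (d' + K)) (lev (d' + K).+1))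
  else true.

Definition survivors K d a := [set i : 'I_(8 * lev (d + K)) | alive K d a i]%SET.

Lemma lev_gt0 k : (0 < lev k)%N. Proof. by rewrite expn_gt0. Qed.

Lemma levS k : lev k.+1 = (lev k * 2 ^ P)%N.
Proof. by rewrite /lev mulnS addnC expnD. Qed.

Lemma card_children M B (S : pred nat) : (0 < B)%N ->
  #|[set i : 'I_(M * B) | S (i %/ B)%N]%SET| = (B * #|[set i : 'I_M | S i]%SET|)%N.
Proof.
move=> B0.
have E n (U : pred nat) : #|[set i : 'I_n | U i]%SET| = (\sum_(0 <= i < n) U i)%N.
  rewrite -sum1_card big_mkord big_mkcond /=.
  by apply: eq_bigr => i _; rewrite inE; case: (U i).
rewrite (E _ (fun i => S (i %/ B)%N)) (E _ S) big_distrr /=.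
elim: M => [|M IH]; first by rewrite mul0n !big_geq.
rewrite big_nat_recr //= -IH (@big_cat_nat _ _ _ (M * B)) //=; last first.
  by rewrite leq_mul2r leqnSn orbT.
congr (_ + _)%N; rewrite -{1}[(M * B)%N]add0n big_addn mulSn addnK.
rewrite (eq_big_nat _ _ (F2 := fun=> S M : nat)).
  by rewrite sum_nat_const_nat subn0 mulnC.
move=> s /andP[_ sB]; rewrite addnC divnMDl // divn_small ?addn0 //.
Qed.

(** A child of a survivor either survives or is hit at least once. *)
Lemma survivors_step K d a0 j : (j < r (d + K))%N ->
  let W := [set i : 'I_(8 * lev (d + K).+1) | alive K d a0 (i %/ 2 ^ P)%N]%SET in
  #|W|%:R <= #|survivors K d.+1 (a0 * r (d + K) + j)|%:R +
    \sum_(lev (d + K) <= n < lev (d + K).+1)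
      hits W (shifted_point (d + K).+1 (a0 * r (d + K) + j) n) :> R.
Proof.
move=> jr /=; set W := (W in #|W|%:R <= _); set k := (d + K)%N in jr W *; set a := (a0 * r k + j)%N.
have r0 : (0 < r k)%N by lia.
have Ea : (a %/ r k = a0)%N by rewrite divnMDl // divn_small // addn0.
rewrite /hits exchange_big /= -!sum1_card !natr_sum.
rewrite [X in _ <= X + _](_ : _ = \sum_(i in W) (i \in survivors K d.+1 a)%:R); last first.
  rewrite [LHS]big_mkcond [RHS]big_mkcond; apply: eq_bigr => i _.
  rewrite !inE /= -/k Ea; case: (alive K d a0 _) => //=.
  by case: (all _ _).
rewrite -big_split /=; apply: ler_sum => i iW.
case iS : (i \in _); first by rewrite lerDl sumr_ge0.
rewrite add0r; move: iS iW; rewrite !inE /= -/k Ea => iS iW.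
move: iS; rewrite iW /= => /negbT/allPn[n nin].
rewrite negbK => hn; rewrite (big_rem n) //= hn lerDl sumr_ge0 //.
Qed.

(** What the passage from level [k] to level [k.+1] requires of the sequence and
    of the resolutions, [H] being the distance beyond which indices decorrelate:
    cells of level [k.+1] are so fine that the points of the block hardly move
    inside them ([sok_fine]), cells of level [k] so coarse that the points of the
    block wind many times around the circle inside them, the first [H] indices
    excepted ([sok_coarse]), the sequence grows fast over [H] indices ([sok_far]),
    and [H * 4 ^ k] is still small compared with the size of the block
    ([sok_H]). *)
Record step_ok (k H : nat) : Prop := StepOk {
  sok_P : (6 <= P)%N;
  sok_Q : (Q k.+1 = Q k * r k)%N;
  sok_Q0 : (0 < Q k.+1)%N;
  sok_pos : forall n, (lev k <= n < lev k.+1)%N -> 0 < q n;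
  sok_fine : forall n, (lev k <= n < lev k.+1)%N ->
    q n * (lev k.+1)%:R ^+ 4 <= (Q k.+1)%:R;
  sok_coarse : forall n, (lev k + H <= n < lev k.+1)%N ->
    (lev k.+1)%:R * (Q k)%:R <= q n;
  sok_far : forall n m, (lev k <= n)%N -> (n + H <= m)%N -> (m < lev k.+1)%N ->
    q n * (lev k.+1)%:R ^+ 3 <= q m;
  sok_H : (48 * H * (2 ^ k) ^ 2 <= lev k.+1)%N }.

Lemma lev_big k : (6 <= P)%N -> 64 * (2 ^ k)%:R ^+ 2 <= (lev k.+1)%:R :> R.
Proof.
move=> P6; rewrite -natrX -natrM ler_nat.
rewrite /lev -expnM (_ : 64 = 2 ^ 6)%N // -expnD leq_exp2l //; nia.
Qed.

(** If at least a proportion [2 ^- k] of the intervals survives in the cell [a0],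
    this proportion drops below [2 ^- k.+1] in at most a proportion [21 * 2 ^- k]
    of its subcells: [few_bad_steps] applies to the children of the survivors with
    [e = 2 ^- k]. *)
Lemma few_bad_children K d a0 H : let k := (d + K)%N in step_ok k H ->
  (8 * lev k <= 2 ^ k * #|survivors K d a0|)%N ->
  #|[set j : 'I_(r k) |
     (2 ^ k.+1 * #|survivors K d.+1 (a0 * r k + j)| < 8 * lev k.+1)%N]%SET|%:R
  <= 21 / (2 ^ k)%:R * (r k)%:R :> R.
Proof.
move=> k [P6 QS Q0 qpos qfine qcoarse qfar HH] hS.
pose W := [set i : 'I_(8 * lev k.+1) | alive K d a0 (i %/ 2 ^ P)%N]%SET.
have cW : (#|W| = 2 ^ P * #|survivors K d a0|)%N.
  rewrite /W /survivors -/k.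
  have -> : (8 * lev k.+1 = (8 * lev k) * 2 ^ P)%N by rewrite levS mulnA.
  by rewrite (@card_children (8 * lev k) (2 ^ P) (alive K d a0)) ?expn_gt0.
have WS : (8 * lev k.+1 <= 2 ^ k * #|W|)%N.
  by rewrite cW levS; nia.
have levle : (lev k <= lev k.+1)%N by rewrite levS leq_pmulr // expn_gt0.
have M4 : (4 <= 8 * lev k.+1)%N by apply: (@leq_mul 4 1); rewrite ?lev_gt0.
have W0 : (0 < #|W|)%N.
  rewrite lt0n; apply/eqP => W0; move: WS.
  by rewrite W0 muln0 leqn0 muln_eq0 /= -leqn0 leqNgt lev_gt0.
set t : R := (2 ^ k)%:R.
have t1 : 1 <= t by rewrite (ler_nat _ 1) expn_gt0.
have Nbig : 64 * t ^+ 2 <= (lev k.+1)%:R := lev_big k P6.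
set N' : R := (lev k.+1)%:R in Nbig qfine qcoarse qfar.
have t2 : 1 <= t ^+ 2 by rewrite exprn_ege1.
have N1 : 1 <= N' by lra.
have tN : t <= t ^+ 2 by rewrite expr2; nra.
have M'E : (8 * lev k.+1)%:R = 8 * N' by rewrite natrM.
have r0 : (0 < r k)%N by move: Q0; rewrite QS; lia.
have Qk0 : (0 < Q k)%N by move: Q0; rewrite QS; lia.
have Q0R : 0 < (Q k.+1)%:R :> R by rewrite ltr0n.
have [//|Hle] : (lev k.+1 - lev k <= H \/ H <= lev k.+1 - lev k)%N by lia.
  move=> Hge; exfalso; move: HH; apply/negP; rewrite -ltnNge.
  have : (2 * lev k <= lev k.+1)%N.
    by rewrite levS mulnC leq_mul2l; apply/orP; right; rewrite -{1}(expn1 2) leq_exp2l //; lia.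
  have : (0 < (2 ^ k) ^ 2)%N by rewrite !expn_gt0.
  have := lev_gt0 k; nia.
have hH : 384 * H%:R <= t^-1 * #|W|%:R.
  have h1 : 8 * N' <= t * #|W|%:R by rewrite -M'E -natrM ler_nat.
  have h2 : 48 * H%:R * t ^+ 2 <= N' by rewrite -!natrX -!natrM ler_nat.
  rewrite [leRHS]mulrC ler_pdivlMr; last by lra.
  have : (384 * H%:R * t) * t <= #|W|%:R * t by lra.
  by rewrite ler_pM2r //; lra.
pose w := (lev k.+1 - lev k - H)%N.
have Hw : (H + w = lev k.+1 - lev k)%N by rewrite /w subnKC.
pose th n := q (lev k + n)%N * a0%:R / (Q k)%:R + (2 * (8 * lev k.+1)%:R)^-1.
pose al n := q (lev k + n)%N / (Q k.+1)%:R.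
have t0 : 0 < t by lra.
have e01 : 0 < t^-1 <= 1 by rewrite invr_gt0 t0 invf_le1.
have hw : 8 * (H + w)%:R <= (8 * lev k.+1)%:R :> R.
  by rewrite -natrM ler_nat Hw leq_mul2l leq_subr.
have fine n : (H <= n < H + w)%N ->
    fine_step (2 / (8 * lev k.+1)%:R) t^-1 (r k) (al n).
  rewrite Hw => nH.
  have /ltn_shift nb : (n < lev k.+1 - lev k)%N by case/andP: nH.
  split; first by rewrite divr_gt0 ?qpos.
    rewrite M'E /al mulrA ler_pdivrMr //.
    have -> : t^-1 ^+ 2 * (2 / (8 * N')) ^+ 2 * (Q k.+1)%:R =
      (Q k.+1)%:R / (16 * t ^+ 2 * N' ^+ 2) by field; rewrite !gt_eqF //; lra.
    rewrite ler_pdivlMr ?mulr_gt0 ?exprn_gt0 //; try lra.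
    apply: le_trans (qfine _ nb).
    have -> : 200 * q (lev k + n)%N * (16 * t ^+ 2 * N' ^+ 2) =
      q (lev k + n)%N * (3200 * t ^+ 2 * N' ^+ 2) by ring.
    rewrite ler_pM2l ?qpos // (_ : N' ^+ 4 = N' ^+ 2 * N' ^+ 2); last by ring.
    by rewrite ler_pM2r ?exprn_gt0 //; nra.
  have -> : al n * (r k)%:R = q (lev k + n)%N / (Q k)%:R.
    by rewrite /al QS natrM; field; rewrite !gt_eqF // ltr0n.
  rewrite mulrA ler_pdivlMr ?ltr0n // (mulrC _ (q _)) ler_pdivlMr //.
  have nb' : (lev k + H <= lev k + n < lev k.+1)%N.
    by case/andP: nb => _ ->; rewrite leq_add2l andbT; case/andP: nH.
  apply: le_trans (qcoarse _ nb').
  have -> : 10 * (Q k)%:R * t = 10 * t * (Q k)%:R by ring.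
  by rewrite ler_pM2r ?ltr0n //; lra.
have far n m : (H <= n)%N -> (n + H <= m)%N -> (m < H + w)%N ->
     200 * al n <= al m * (t^-1 ^+ 2 * (2 / (8 * lev k.+1)%:R)).
  rewrite Hw => nH nm mw; rewrite M'E /al.
  have nm' : (n <= m)%N := leq_trans (leq_addr H n) nm.
  have /andP[nb1 nb2] := ltn_shift mw.
  have nb : (lev k <= lev k + n < lev k.+1)%N.
    by rewrite leq_addr /=; apply: leq_ltn_trans nb2; rewrite leq_add2l.
  have -> : q (lev k + m)%N / (Q k.+1)%:R * (t^-1 ^+ 2 * (2 / (8 * N'))) =
    q (lev k + m)%N / (4 * t ^+ 2 * N') / (Q k.+1)%:R.
    by field; rewrite !gt_eqF //; lra.
  rewrite mulrA ler_pM2r ?invr_gt0 // ler_pdivlMr ?mulr_gt0 ?exprn_gt0 //; try lra.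
  have h := qfar (lev k + n)%N (lev k + m)%N.
  apply: le_trans (h (leq_addr _ _) _ nb2); last by rewrite -addnA leq_add2l.
  have -> : 200 * q (lev k + n)%N * (4 * t ^+ 2 * N') =
    q (lev k + n)%N * (800 * t ^+ 2 * N') by ring.
  rewrite ler_pM2l ?qpos // (_ : N' ^+ 3 = N' ^+ 2 * N'); last by ring.
  by rewrite ler_pM2r; [nra|lra].
have := @few_bad_steps R (8 * lev k.+1) (r k) W t^-1 w H th al e01 M4 W0 hw hH fine far.
apply: le_trans; rewrite ler_nat; apply: subset_leq_card.
apply/fintype.subsetP => j; rewrite !inE => hj.
have := @survivors_step K d a0 j (ltn_ord j); rewrite -/k -/W /=.
have -> : \sum_(lev k <= n < lev k.+1) hits W (shifted_point k.+1 (a0 * r k + j) n) =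
  \sum_(0 <= n < H + w) hits W (th n + al n * j%:R).
  rewrite -{1}[lev k]add0n big_addn Hw; apply: eq_bigr => n _.
  rewrite /shifted_point /th /al addnC QS; congr (hits W _).
  rewrite natrD !natrM; field; rewrite !gt_eqF ?ltr0n // -?natrM ?ltr0n //.
  by rewrite ?muln_gt0 ?lev_gt0.
set S := \sum_(_ <= _ < _) _ => h.
have h1 : t * #|survivors K d.+1 (a0 * r k + j)|%:R * 2 < 8 * N'.
  by rewrite -M'E -!natrM ltr_nat mulnAC -expnSr.
have h2 : 8 * N' <= t * #|W|%:R by rewrite -M'E -natrM ler_nat.
have : t * (#|survivors K d.+1 (a0 * r k + j)|%:R * 2) < t * #|W|%:R by lra.
by rewrite ltr_pM2l //; lra.
Qed.

End Process.

(** * The gap condition decorrelates distant indices *)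

Section Growth.
Variable R : realType.

Lemma bernoulli_ineq (x : R) h : 0 <= x -> 1 + h%:R * x <= (1 + x) ^+ h.
Proof.
move=> x0; elim: h => [|h IH]; first by rewrite mul0r addr0 expr0.
rewrite exprS -natr1; have h0 : 0 <= h%:R :> R by [].
have : (1 + x) * (1 + h%:R * x) <= (1 + x) * (1 + x) ^+ h by rewrite ler_wpM2l //; lra.
have : 0 <= h%:R * (x * x) by rewrite !mulr_ge0.
lra.
Qed.

Lemma growth_exp (q : nat -> R) (x : R) n h : 0 <= x ->
  (forall i, (n <= i < n + h)%N -> q i * (1 + x) <= q i.+1) ->
  q n * (1 + x) ^+ h <= q (n + h)%N.
Proof.
move=> x0; elim: h => [|h IH] hq; first by rewrite expr0 mulr1 addn0.
rewrite exprSr mulrA addnS; apply: le_trans (hq _ _); last first.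
  by rewrite leq_addr addnS /= ltnS.
rewrite ler_wpM2r ?addr_ge0 // IH // => i /andP[i1 i2].
by apply: hq; rewrite i1 /= addnS ltnS ltnW.
Qed.

(** Bernoulli's inequality gives a factor [g] over [h] indices; iterating it [p]
    times gives any power of [g] at a cost linear in [p]. *)
Lemma growth_blocks (q : nat -> R) (x g : R) n h p : 0 <= x -> 0 <= g ->
  g <= h%:R * x -> 0 <= q n ->
  (forall i, (n <= i < n + p * h)%N -> q i * (1 + x) <= q i.+1) ->
  q n * g ^+ p <= q (n + p * h)%N.
Proof.
move=> x0 g0 gx qn0 /(growth_exp x0); apply: le_trans.
rewrite mulnC exprM ler_wpM2l // lerXn2r ?nnegrE ?exprn_ge0 ?addr_ge0 //.
by apply: le_trans (bernoulli_ineq h x0); rewrite ler_wpDl.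
Qed.

Section Resolution.
Variables (P : nat) (q : nat -> R).

Definition resolution_target k : R := (lev P k)%:R ^+ 4 * q (lev P k).

(** Successive resolutions divide each other, so that cells are nested, and each
    exceeds its target as little as this allows. *)
Fixpoint resolution k : nat :=
  if k is k'.+1 then
    (resolution k' * (Num.truncn (resolution_target k'.+1 / (resolution k')%:R)).+1)%N
  else 1%N.

Definition resolution_ratio k : nat :=
  (Num.truncn (resolution_target k.+1 / (resolution k)%:R)).+1.

Lemma resolution_gt0 k : (0 < resolution k)%N.
Proof. by elim: k => //= k IH; rewrite muln_gt0 IH. Qed.

Lemma resolution_ge k : resolution_target k.+1 <= (resolution k.+1)%:R.
Proof.
by rewrite /= natrM mulrC -ler_pdivrMr ?ltr0n ?resolution_gt0 // ltW // truncnS_gt.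
Qed.

Lemma resolution_le k : 0 <= resolution_target k.+1 ->
  (resolution k.+1)%:R <= resolution_target k.+1 + (resolution k)%:R.
Proof.
move=> h; have r0 : 0 < (resolution k)%:R :> R by rewrite ltr0n resolution_gt0.
rewrite /= natrM -natr1 mulrDr mulr1 lerD2r mulrC -ler_pdivlMr //.
by rewrite truncn_le divr_ge0 // ltW.
Qed.

Variable k0 : nat.
Hypothesis P6 : (6 <= P)%N.
Hypothesis q_gt0 : forall n, (lev P k0 <= n)%N -> 0 < q n.
(* With [n < 2 ^ (P * k.+1)] and [eps = 4 / P], this is the gap condition with
   [n ^ (1 - eps)] replaced by its upper bound over the block. *)
Hypothesis q_gap : forall k n, (lev P k0 <= n)%N -> (n < lev P k.+1)%N ->
  q n * (1 + ((2 ^ k.+1) ^ (P - 4))%:R^-1) <= q n.+1.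

Lemma leq_lev k k' : (k <= k')%N -> (lev P k <= lev P k')%N.
Proof. by move=> kk'; rewrite leq_exp2l // leq_mul2l kk' orbT. Qed.

Let P_gt0 : (0 < P)%N. Proof. exact: leq_trans P6. Qed.
Let P_gt3 : (3 < P)%N. Proof. exact: leq_trans P6. Qed.

Lemma ltn_lev k : (k < lev P k)%N.
Proof.
apply: (@leq_trans (2 ^ k)); first exact: ltn_expl.
by rewrite leq_exp2l // leq_pmull.
Qed.

Lemma q_homo n m : (lev P k0 <= n)%N -> (n <= m)%N -> q n <= q m.
Proof.
move=> n0 /subnKC <-; elim: (m - n)%N => [|d IH]; first by rewrite addn0.
apply: (le_trans IH); rewrite addnS.
have nd : (lev P k0 <= n + d)%N by rewrite (leq_trans n0) // leq_addr.
apply: le_trans (q_gap (k := n + d) nd _); last first.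
  by apply: ltn_trans (ltn_lev _) _; rewrite ltn_exp2l // ltn_mul2l ltnSn andbT.
by rewrite ler_peMr ?lerDl ?invr_ge0 // ltW // q_gt0.
Qed.

Lemma resolution_target_gt0 k : (k0 <= k)%N -> 0 < resolution_target k.
Proof. by move=> kk; rewrite mulr_gt0 ?exprn_gt0 ?ltr0n ?lev_gt0 ?q_gt0 ?leq_lev. Qed.

Lemma resolution_targetS k : (k0 <= k)%N -> 2 * resolution_target k <= resolution_target k.+1.
Proof.
move=> kk; rewrite /resolution_target mulrA; apply: ler_pM.
- by rewrite mulr_ge0 // exprn_ge0.
- by rewrite ltW // q_gt0 // leq_lev.
- rewrite levS natrM exprMn mulrC ler_wpM2l ?exprn_ge0 //.
  by rewrite -natrX (ler_nat _ 2) -expnM -{1}(expn1 2) leq_exp2l // muln_gt0 P_gt0.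
- by apply: q_homo; rewrite leq_lev.
Qed.

(** Rounding up to a multiple costs the previous resolution, which is a geometric
    loss since the targets at least double. *)
Lemma resolution_le_target : exists C : R, 2 <= C /\
  forall k, (k0 <= k)%N -> (resolution k)%:R <= C * resolution_target k.
Proof.
have X0 := resolution_target_gt0 (leqnn k0).
pose C := 2 + (resolution k0)%:R / resolution_target k0; exists C.
have C2 : 2 <= C by rewrite /C lerDl divr_ge0 // ltW.
split=> // k /subnKC <-; elim: (k - k0)%N => [|d IH].
  by rewrite addn0 mulrDl divfK ?gt_eqF // lerDr mulr_ge0 // ltW.
rewrite addnS; have dk : (k0 <= k0 + d)%N by rewrite leq_addr.
have X1 : 0 < resolution_target (k0 + d).+1 by rewrite resolution_target_gt0 // ltnW.
apply: (le_trans (resolution_le (ltW X1))).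
have h := resolution_targetS dk.
have : C * (2 * resolution_target (k0 + d)%N) <= C * resolution_target (k0 + d).+1.
  by rewrite ler_wpM2l //; lra.
have : 2 * resolution_target (k0 + d).+1 <= C * resolution_target (k0 + d).+1 by rewrite ler_pM2r.
lra.
Qed.

(** In units of [t = 2 ^ k.+1], the relative gap is [t ^- (P - 4)], so
    [t ^ (P - 3)] indices produce a factor [t], and [6 * P] times as many produce
    [t ^ (6 * P)], the sixth power of the size of the block. *)
Lemma q_far k n m (H := (6 * P * (2 ^ k.+1) ^ (P - 3))%N) :
  (lev P k0 <= n)%N -> (n + H <= m)%N -> (m < lev P k.+1)%N ->
  q n * (lev P k.+1)%:R ^+ 6 <= q m.
Proof.
move=> n0 nm mk; apply: le_trans (q_homo _ nm); last first.
  by rewrite (leq_trans n0) // leq_addr.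
have -> : (lev P k.+1)%:R ^+ 6 = (2 ^ k.+1)%:R ^+ (6 * P) :> R.
  by rewrite -!natrX /lev -!expnM; congr (2 ^ _)%:R; rewrite (mulnC P) -mulnA (mulnC P).
apply: (@growth_blocks q ((2 ^ k.+1) ^ (P - 4))%:R^-1); rewrite ?invr_ge0 //.
- by rewrite ler_pdivlMr ?ltr0n ?expn_gt0 // -natrM -expnS ler_nat subnSK.
- by rewrite ltW // q_gt0.
- move=> i /andP[i1 i2]; apply: q_gap; first exact: leq_trans i1.
  by apply: (leq_trans i2); apply: leq_trans nm _; exact: ltnW.
Qed.

Lemma step_ok_eventually : exists k1, forall k, (k1 <= k)%N ->
  exists H, step_ok P q resolution resolution_ratio k H.
Proof.
have [C [C2 hC]] := resolution_le_target.
pose k1 := (maxn k0 (maxn (36 * P) (Num.truncn C)))%N.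
exists k1 => k; rewrite !geq_max => /and3P[kk0 kP kC].
exists (6 * P * (2 ^ k.+1) ^ (P - 3))%N; split => //.
- exact: resolution_gt0.
- by move=> n /andP[n1 _]; apply: q_gt0; rewrite (leq_trans _ n1) ?leq_lev.
- move=> n /andP[n1 n2]; apply: le_trans (resolution_ge k); rewrite mulrC.
  rewrite ler_wpM2l ?exprn_ge0 //; apply: q_homo (ltnW n2).
  by rewrite (leq_trans _ n1) ?leq_lev.
- move=> n /andP[n1 n2]; apply: le_trans (q_far (leq_lev kk0) n1 n2).
  set N' : R := (lev P k.+1)%:R.
  have N'0 : 0 < N' by rewrite ltr0n lev_gt0.
  have CN : C <= N'.
    apply: ltW; apply: lt_le_trans (truncnS_gt C) _; rewrite ler_nat.
    by apply: leq_trans (ltn_lev _); rewrite ltnS ltnW // ltnS.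
  have q0 : 0 < q (lev P k) by rewrite q_gt0 // leq_lev.
  apply: le_trans (_ : N' * (C * (N' ^+ 4 * q (lev P k))) <= _).
    rewrite ler_wpM2l //.
    apply: le_trans (hC _ kk0) _; rewrite ler_wpM2l //; first by lra.
    rewrite ler_wpM2r ?(ltW q0) // lerXn2r ?nnegrE //. 
    by rewrite ler_nat leq_lev.
  have -> : N' * (C * (N' ^+ 4 * q (lev P k))) = q (lev P k) * (C * N' ^+ 5) by ring.
  by rewrite ler_pM2l // (exprS N' 5) ler_pM2r ?exprn_gt0.
- move=> n m n1 nm mk.
  apply: le_trans (q_far (leq_trans (leq_lev kk0) n1) nm mk).
  rewrite ler_wpM2l ?(ltW (q_gt0 (leq_trans (leq_lev kk0) n1))) //.
  by rewrite ler_weXn2l // (ler_nat _ 1) lev_gt0.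
- have hk : (36 * P <= 2 ^ k)%N by rewrite (leq_trans kP) // ltnW // ltn_expl.
  have -> : lev P k.+1 = ((2 ^ k.+1) ^ (P - 3) * (2 ^ k.+1) ^ 3)%N.
    by rewrite -expnD subnK ?(ltnW P_gt3) // /lev -expnM mulnC.
  move: ((2 ^ k.+1) ^ (P - 3))%N => h; rewrite (expnS 2 k).
  move: (2 ^ k)%N hk => t hk.
  apply: (@leq_trans (h * (8 * (36 * P) * t ^ 2))%N); first by rewrite leq_eqVlt; apply/orP; left; apply/eqP; ring.
  rewrite leq_mul2l; apply/orP; right.
  have -> : ((2 * t) ^ 3 = 8 * t * t ^ 2)%N by rewrite expnMn (expnS t 2) mulnA.
  by rewrite leq_mul2r leq_mul2l hk !orbT.
Qed.

End Resolution.
End Growth.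

(** * From a surviving branch to the target point *)

Section Target.
Variable R : realType.

(** The tested interval extends half an interval beyond interval [i] on each
    side. *)
Lemma far_of_miss (M y i d : R) (m : int) : 0 < M ->
  ~~ hit (2 / M) (y + (2 * M)^-1 - i / M) -> i / M <= d <= (i + 1) / M ->
  (2 * M)^-1 <= `|y - d - m%:~R|.
Proof.
move=> M0; rewrite /hit -leNgt; set u := (2 * M)^-1.
set z := y + _ - _ => hz /andP[d1 d2].
have /andP[f1 f2] := floor_itv z; rewrite rmorphD /= in f2.
set fl := Num.floor z in hz f1 f2.
have E2 : 2 / M = 4 * u by rewrite /u; field; rewrite gt_eqF.
have E1 : (i + 1) / M = i / M + 2 * u by rewrite /u; field; rewrite gt_eqF.
rewrite E2 in hz; rewrite E1 in d2.
have Ez : y = z - u + i / M by rewrite /z; ring.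
have u0 : 0 < u by rewrite invr_gt0 mulr_gt0.
move: Ez hz f1 f2 d1 d2; move: (i / M) => v; rewrite /z.
case: (lerP m fl) => hm Ez hz f1 f2 d1 d2.
  have : m%:~R <= fl%:~R :> R by rewrite ler_int.
  by move=> hm'; rewrite ger0_norm; lra.
have : fl%:~R + 1 <= m%:~R :> R.
  by rewrite -(rmorphD _ fl 1) ler_int lezD1.
by move=> hm'; rewrite ler0_norm; lra.
Qed.

Variables (P : nat) (q : nat -> R) (Q r : nat -> nat).
Hypothesis QS : forall k, (Q k.+1 = Q k * r k)%N.
Hypothesis Q_gt0 : forall k, (0 < Q k)%N.

Definition cell (x : R) k : nat := Num.truncn (x * (Q k)%:R).

Lemma cell_itv x k : 0 <= x ->
  (cell x k)%:R / (Q k)%:R <= x < (cell x k)%:R / (Q k)%:R + (Q k)%:R^-1.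
Proof.
move=> x0; have Qk0 : 0 < (Q k)%:R :> R by rewrite ltr0n.
have /andP[c1 c2] : (cell x k)%:R <= x * (Q k)%:R < (cell x k).+1%:R.
  by apply: truncn_itv; rewrite mulr_ge0 // ltW.
rewrite ler_pdivrMr // c1 /= -[X in _ + X]mul1r -mulrDl natr1 ltr_pdivlMr //.
Qed.

Lemma cell_lt x k : 0 <= x < 1 -> (cell x k < Q k)%N.
Proof.
move=> /andP[x0 x1]; have Qk0 : 0 < (Q k)%:R :> R by rewrite ltr0n.
rewrite /cell truncn_lt_nat; last by rewrite mulr_ge0 // ltW.
by rewrite gtr_pMl.
Qed.

Lemma cell_ancestor x k : 0 <= x -> (cell x k.+1 %/ r k)%N = cell x k.
Proof.
move=> x0; have r0 : (0 < r k)%N by move: (Q_gt0 k.+1); rewrite QS muln_gt0 => /andP[].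
have xQ j : 0 <= x * (Q j)%:R by rewrite mulr_ge0.
apply/eqP; rewrite eqn_leq; apply/andP; split.
  rewrite /cell truncn_ge_nat // -(ler_pM2r (_ : 0 < (r k)%:R)) ?ltr0n //.
  rewrite -mulrA -natrM -natrM -QS.
  apply: le_trans (_ : (cell x k.+1)%:R <= _); first by rewrite ler_nat leq_trunc_div.
  by rewrite /cell truncn_le.
rewrite leq_divRL // /cell truncn_ge_nat // QS !natrM mulrA ler_wpM2r //.
by rewrite truncn_le.
Qed.

Variables (K : nat) (x : R).
Hypothesis x01 : 0 <= x < 1.
Hypothesis steps : forall k, (K <= k)%N -> exists H, step_ok P q Q r k H.

Let M k : R := (8 * lev P k)%:R.
Let M_gt0 k : 0 < M k. Proof. by rewrite ltr0n muln_gt0 lev_gt0. Qed.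
Let x_ge0 : 0 <= x. Proof. by case/andP: x01. Qed.

(** The indices of the last block avoid the interval itself, and those of earlier
    blocks avoid its ancestors, which contain it. *)
Lemma alive_far d i e n (m : int) :
  alive P q Q r K d (cell x (d + K)) i ->
  i%:R / M (d + K) <= e <= i.+1%:R / M (d + K) ->
  (lev P K <= n < lev P (d + K))%N ->
  (32 * 2 ^+ P * n%:R)^-1 <= `|q n * x - e - m%:~R|.
Proof.
elim: d i => [|d IH] i; first by move=> _ _ /andP[n1]; rewrite ltnNge n1.
move=> /=; rewrite cell_ancestor //; set k := (d + K)%N in IH *.
move=> /andP[ha hn] he /andP[n1 n2]; case: (ltnP n (lev P k)) => [nk|kn].
  apply: (IH (i %/ 2 ^ P)%N) => //; last by rewrite n1.
  case/andP: he => e1 e2.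
  have EM : M k.+1 = M k * (2 ^ P)%:R by rewrite /M levS -natrM mulnA.
  have B0 : 0 < (2 ^ P)%:R :> R by rewrite ltr0n expn_gt0.
  apply/andP; split.
    apply: le_trans e1; rewrite ler_pdivrMr // EM.
    have -> : i%:R / (M k * (2 ^ P)%:R) * M k = i%:R / (2 ^ P)%:R.
      by rewrite invfM mulrA mulrAC divfK // gt_eqF.
    by rewrite ler_pdivlMr // -natrM ler_nat leq_trunc_div.
  apply: (le_trans e2); rewrite ler_pdivlMr // EM.
  have -> : i.+1%:R / (M k * (2 ^ P)%:R) * M k = i.+1%:R / (2 ^ P)%:R.
    by rewrite invfM mulrA mulrAC divfK // gt_eqF.
  by rewrite ler_pdivrMr // -natrM ler_nat ltn_ceil // expn_gt0.
have [H [P6 _ _ qpos qfine _ _ _]] := steps (leq_addl d K : (K <= k)%N).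
have nb : (lev P k <= n < lev P k.+1)%N by rewrite kn.
have miss : avoids P q Q k.+1 (cell x k.+1) i n.
  by apply: (allP hn); rewrite mem_index_iota.
have i1 : i.+1%:R = i%:R + 1 :> R by rewrite natr1.
rewrite i1 in he.
have := @far_of_miss (M k.+1) (q n * (cell x k.+1)%:R / (Q k.+1)%:R) i%:R e m
  (M_gt0 _) miss he.
have /andP[c1 c2] := cell_itv k.+1 x_ge0.
set c : R := _ / _ in c1 c2; rewrite -mulrA -/c => far.
have q0 := qpos _ nb.
have Q0 : 0 < (Q k.+1)%:R :> R by rewrite ltr0n.
have Nbig := lev_big R k P6.
have Ni : 64 <= (lev P k.+1)%:R :> R.
  by apply: le_trans Nbig; rewrite ler_peMr // -natrX (ler_nat _ 1) !expn_gt0.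
have EM : M k.+1 = 8 * (lev P k.+1)%:R by rewrite /M natrM.
set N : R := (lev P k.+1)%:R in Ni EM qfine.
have N0 : 0 < N by lra.
(* The tree only sees the corner [c] of the cell of [x]; this costs at most half
   of the margin kept around the point of the sequence. *)
have small : q n * (x - c) <= (4 * M k.+1)^-1.
  apply: le_trans (_ : q n * (Q k.+1)%:R^-1 <= _).
    by rewrite ler_wpM2l //; [exact: ltW | lra].
  rewrite ler_pdivrMr // EM [leRHS]mulrC ler_pdivlMr ?mulr_gt0 //.
  apply: le_trans (qfine _ nb); rewrite ler_wpM2l //; first exact: ltW.
  have N1 : 1 <= N by lra.
  have N2 : N <= N ^+ 2 by rewrite expr2 ler_peMr // ltW.
  have : N ^+ 2 * 64 <= N ^+ 2 * N ^+ 2 by rewrite ler_pM2l ?exprn_gt0 //; lra.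
  have -> : N ^+ 4 = N ^+ 2 * N ^+ 2 by ring.
  lra.
have pos : 0 <= q n * (x - c) by rewrite mulr_ge0 ?subr_ge0 // ltW.
have tri := ler_normD (q n * x - e - m%:~R) (- (q n * (x - c))).
have E0 : q n * x - e - m%:~R + - (q n * (x - c)) = q n * c - e - m%:~R by ring.
rewrite E0 normrN (ger0_norm pos) in tri.
have E1 : (2 * M k.+1)^-1 = 2 * (4 * M k.+1)^-1 by field; rewrite gt_eqF.
have : (32 * 2 ^+ P * n%:R)^-1 <= (4 * M k.+1)^-1.
  have n0 : 0 < n%:R :> R by rewrite ltr0n (leq_trans _ kn) // lev_gt0.
  rewrite lef_pV2 ?posrE ?mulr_gt0 ?exprn_gt0 //.
  rewrite EM /N levS natrM natrX.
  have : 2 ^+ P * (lev P k)%:R <= 2 ^+ P * n%:R :> R.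
    by rewrite ler_wpM2l ?exprn_ge0 // ler_nat.
  lra.
lra.
Qed.

Hypothesis inhabited : forall d, exists i,
  ((i < 8 * lev P (d + K)) && alive P q Q r K d (cell x (d + K)) i)%N.

(* The leftmost survivors never move to the left from one level to the next,
   because the parent of a survivor survives.  Their supremum is the point sought. *)
Let leftmost d : nat := ex_minn (inhabited d).
Let delta d : R := (leftmost d)%:R / M (d + K).

Let delta_homo d d' : (d <= d')%N -> delta d <= delta d'.
Proof.
move=> /subnKC <-; elim: (d' - d)%N => [|j IH]; first by rewrite addn0.
apply: (le_trans IH); rewrite addnS; move: (d + j)%N => {d d' IH j}d.
rewrite /delta /leftmost; case: ex_minnP => i _ imin.
case: ex_minnP => i' /andP[i'M /= /andP[]]; rewrite cell_ancestor // => ha _ _.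
set k := (d + K)%N in imin ha i'M *.
have EM : M k.+1 = M k * (2 ^ P)%:R by rewrite /M levS -natrM mulnA.
have B0 : 0 < (2 ^ P)%:R :> R by rewrite ltr0n expn_gt0.
have : (i <= i' %/ 2 ^ P)%N.
  apply: imin; rewrite ha andbT ltn_divLR ?expn_gt0 // -mulnA -levS //.
rewrite leq_divRL ?expn_gt0 // => h.
rewrite ler_pdivrMr // -[leRHS]mulrA EM.
have -> : (M k * (2 ^ P)%:R)^-1 * M k = (2 ^ P)%:R^-1 :> R by rewrite invfM mulrAC mulVf ?mul1r // gt_eqF.
by rewrite ler_pdivlMr // -natrM ler_nat.
Qed.

(** At each index the bound holds, with a factor 2 to spare, for the left ends of
    all sufficiently late leftmost survivors, hence for their supremum. *)
Lemma target_exists : exists e : R, 0 <= e < 1 /\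
  forall n (m : int), (lev P K <= n)%N ->
    (64 * 2 ^+ P * n%:R)^-1 <= `|q n * x - e - m%:~R|.
Proof.
pose S := range delta.
have delta1 d : delta d <= 1.
  rewrite /delta /leftmost; case: ex_minnP => i /andP[iM _] _.
  by rewrite ler_pdivrMr // mul1r ler_nat ltnW.
have S_sup : has_sup S.
  by split; [exists (delta 0), 0%N | exists 1 => _ [d _ <-]].
have far n (m : int) : (lev P K <= n)%N ->
    (64 * 2 ^+ P * n%:R)^-1 <= `|q n * x - sup S - m%:~R|.
  move=> n1; have n0 : (0 < n)%N by apply: leq_trans n1; exact: lev_gt0.
  have u0 : 0 < (64 * 2 ^+ P * n%:R)^-1 :> R.
    by rewrite invr_gt0 !mulr_gt0 ?exprn_gt0 ?ltr0n.
  set u := (64 * 2 ^+ P * n%:R)^-1 in u0 *.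
  have [_ [d0 _ <-] hd0] := sup_adherent u0 S_sup.
  have [? [P6 _ _ _ _ _ _ _]] := steps (leqnn K).
  pose d := maxn d0 n.
  have nd : (n < lev P (d + K))%N.
    apply: leq_ltn_trans (ltn_lev P6 (d + K)).
    by rewrite (leq_trans (leq_maxr d0 n)) // leq_addr.
  have dd : delta d0 <= delta d by apply: delta_homo; exact: leq_maxl.
  have ds : delta d <= sup S by apply: sup_upper_bound => //; exists d.
  have : (32 * 2 ^+ P * n%:R)^-1 <= `|q n * x - delta d - m%:~R|.
    have [i /andP[iM ia] Ei] : exists2 i, (i < 8 * lev P (d + K))%N &&
        alive P q Q r K d (cell x (d + K)) i & delta d = i%:R / M (d + K).
      by rewrite /delta /leftmost; case: ex_minnP => i hi _; exists i.
    apply: (alive_far m ia); last by rewrite n1.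
    by rewrite Ei lexx /= ler_pM2r ?invr_gt0 // ler_nat.
  have -> : (32 * 2 ^+ P * n%:R)^-1 = 2 * u :> R.
    rewrite /u; field; rewrite !gt_eqF ?ltr0n //; exact: exprn_gt0.
  have tri := ler_normD (q n * x - sup S - m%:~R) (sup S - delta d).
  have E0 : q n * x - sup S - m%:~R + (sup S - delta d) = q n * x - delta d - m%:~R by ring.
  rewrite E0 (ger0_norm (_ : 0 <= sup S - delta d)) in tri; last by rewrite subr_ge0.
  by lra.
have sup0 : 0 <= sup S.
  apply: (@le_trans _ _ (delta 0)); first by rewrite divr_ge0 // ltW.
  by apply: sup_upper_bound => //; exists 0%N.
have sup1 : sup S <= 1.
  by apply: ge_sup; [exists (delta 0), 0%N | move=> _ [d _ <-]].
case: (ltrP (sup S) 1) => h1; first by exists (sup S); rewrite sup0.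
exists 0; split=> [|n m n1]; first by rewrite lexx ltr01.
have ES : sup S = 1 by apply/eqP; rewrite eq_le sup1.
have := far n (m - 1) n1; rewrite ES rmorphB /=.
by rewrite (_ : q n * x - 1 - (m%:~R - 1) = q n * x - 0 - m%:~R); last ring.
Qed.

End Target.

(** * The exceptional set is negligible *)

Local Open Scope classical_set_scope.
Local Open Scope ring_scope.

Section BadSet.
Variable R : realType.
Variables (P : nat) (q : nat -> R) (Q r : nat -> nat).
Hypothesis QS : forall k, (Q k.+1 = Q k * r k)%N.
Hypothesis Q_gt0 : forall k, (0 < Q k)%N.
Let mu := @lebesgue_measure R.

(** The proportion of survivors, at least [2 ^- k] in the parent cell, falls below
    [2 ^- k.+1] in the cell [a]. *)
Definition bad K d a : bool :=
  ((8 * lev P (d + K) <= 2 ^ (d + K) * #|survivors P q Q r K d (a %/ r (d + K))|) &&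
   (2 ^ (d + K).+1 * #|survivors P q Q r K d.+1 a| < 8 * lev P (d + K).+1))%N.

Definition cell_interval k a : set R :=
  [set` `[a%:R / (Q k)%:R, a%:R / (Q k)%:R + (Q k)%:R^-1[ ].

Definition bad_interval K d a : set R :=
  if bad K d a then cell_interval (d + K).+1 a else set0.

Definition bad_set K d : set R :=
  \big[setU/set0]_(a < Q (d + K).+1) bad_interval K d a.

Lemma bad_set_measurable K d : measurable (bad_set K d).
Proof.
apply: bigsetU_measurable => a _; rewrite /bad_interval.
by case: ifP => // _; exact: measurable_itv.
Qed.

Lemma cell_interval_measure k a : mu (cell_interval k a) = ((Q k)%:R^-1)%:E.
Proof.
have Qk0 : 0 < (Q k)%:R :> R by rewrite ltr0n.
rewrite /mu /cell_interval lebesgue_measure_itv /= lte_fin ltrDl invr_gt0 Qk0.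
by rewrite -EFinB addrAC subrr add0r.
Qed.

Lemma sum_bad_le K d : (exists H, step_ok P q Q r (d + K) H) ->
  \sum_(0 <= a < Q (d + K).+1) (bad K d a)%:R
   <= 21 / (2 ^ (d + K))%:R * (Q (d + K).+1)%:R :> R.
Proof.
move=> [H step]; set k := (d + K)%N in step *.
have r0 : (0 < r k)%N by move: (Q_gt0 k.+1); rewrite QS muln_gt0 => /andP[].
rewrite QS big_nat_blocks.
apply: (@le_trans _ _ (\sum_(0 <= a0 < Q k) (21 / (2 ^ k)%:R * (r k)%:R))); last first.
  by rewrite sumr_const_nat subn0 -[leLHS]mulr_natr natrM (mulrC (Q k)%:R) mulrA.
apply: ler_sum => a0 _; rewrite big_mkord.
case: (boolP (8 * lev P k <= 2 ^ k * #|survivors P q Q r K d a0|)%N) => hS; last first.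
  rewrite big1 ?mulr_ge0 ?divr_ge0 // => j _.
  by rewrite /bad -/k divnMDl // divn_small // addn0 (negbTE hS).
apply: le_trans (few_bad_children step hS).
rewrite -sum1_card natr_sum [leRHS]big_mkcond.
apply: ler_sum => j _; rewrite inE /bad -/k divnMDl // divn_small // addn0 hS /=.
by case: ifP.
Qed.

Lemma bad_set_measure_le K d : (exists H, step_ok P q Q r (d + K) H) ->
  (mu (bad_set K d) <= (21 / (2 ^ (d + K))%:R)%:E)%E.
Proof.
move=> step; have Qk0 : 0 < (Q (d + K).+1)%:R :> R by rewrite ltr0n.
have mF a : (a < Q (d + K).+1)%N ->
    measurable (bad_interval K d a).
  by move=> _; rewrite /bad_interval; case: ifP => // _; exact: measurable_itv.
apply: (le_trans (Boole_inequality mu mF)).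
apply: (@le_trans _ _ (\sum_(a < Q (d + K).+1)
    ((bad K d a)%:R / (Q (d + K).+1)%:R)%:E)%E).
  apply: lee_sum => a _; rewrite /bad_interval; case: ifP => _; last by rewrite measure0 mul0r.
  have h : (mu (cell_interval (d + K).+1 a) <= (1 / (Q (d + K).+1)%:R)%:E)%E.
    by rewrite cell_interval_measure mul1r.
  exact: h.
rewrite sumEFin lee_fin -mulr_suml ler_pdivrMr //.
by rewrite -(big_mkord xpredT (fun a => (bad K d a)%:R)) sum_bad_le.
Qed.

Lemma not_bad_inhabited K (x : R) : 0 <= x < 1 ->
  (forall d, ~ bad_set K d x) -> forall d, exists i,
  ((i < 8 * lev P (d + K)) && alive P q Q r K d (cell Q x (d + K)) i)%N.
Proof.
move=> x01 good; have x0 : 0 <= x by case/andP: x01.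
have many d : (8 * lev P (d + K) <=
    2 ^ (d + K) * #|survivors P q Q r K d (cell Q x (d + K))|)%N.
  elim: d => [|d IH].
    rewrite (_ : #|_| = #|'I_(8 * lev P (0 + K))|); last first.
      by apply: eq_card => i; rewrite !inE.
    by rewrite card_ord leq_pmull // expn_gt0.
  rewrite leqNgt; apply/negP => hb; apply: (good d).
  have cQ := cell_lt Q_gt0 (d + K).+1 x01.
  rewrite /bad_set -bigcup_mkord; exists (cell Q x (d + K).+1) => //=.
  rewrite /bad_interval /bad (cell_ancestor QS Q_gt0 (d + K) x0) IH hb /=.
  by rewrite /cell_interval /= in_itv /= cell_itv.
move=> d; have : (0 < #|survivors P q Q r K d (cell Q x (d + K))|)%N.
  have := many d; case: #|_| => //; rewrite muln0 leqNgt muln_gt0 lev_gt0 //.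
by case/card_gt0P => i; rewrite inE => ai; exists i; rewrite ltn_ord.
Qed.

(** The points that meet a bad cell in the process started at level [n] have
    measure at most a constant times [2 ^- n], and an exceptional point belongs to
    these sets for all [n]. *)
Lemma bad_negligible k1 : (forall k, (k1 <= k)%N -> exists H, step_ok P q Q r k H) ->
  mu.-negligible (\bigcap_n \bigcup_d bad_set (n + k1).+1 d).
Proof.
move=> steps; pose U n := \bigcup_d bad_set (n + k1).+1 d.
have mU n : measurable (U n).
  by apply: bigcup_measurable => d _; exact: bad_set_measurable.
exists (\bigcap_n U n); split => //.
  by apply: bigcap_measurable => // n _; exact: mU.
apply/eqP; rewrite eq_le measure_ge0 andbT; apply/lee_addgt0Pr => e e0.
rewrite add0e; pose n := Num.truncn (21 / e).
apply: (@le_trans _ _ (mu (U n))).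
  apply: le_measure; rewrite ?inE; last exact: bigcap_inf.
    by apply: bigcap_measurable => // j _; exact: mU.
  exact: mU.
have hU : (mu (U n) <= (21 / 2 ^+ (n + k1))%:E)%E.
  have mB d : measurable (bad_set (n + k1).+1 d) by exact: bad_set_measurable.
  apply: (le_trans (generalized_Boole_inequality mu mB (mU n))).
  have <- := cvg_lim _ (@cvg_geometric_eseries_half R 21 (n + k1)) => //.
  apply: lee_nneseries => d _ //; apply: bad_set_measure_le.
  by apply: steps; rewrite -addSnnS addnA leq_addl.
apply: (le_trans hU); rewrite lee_fin ler_pdivrMr ?exprn_gt0 // mulrC -ler_pdivrMr //.
apply: ltW; apply: lt_le_trans (truncnS_gt _) _; rewrite -natrX ler_nat -/n.
by apply: leq_trans (ltn_expl (n + k1) _) => //; rewrite ltnS leq_addr.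
Qed.

End BadSet.

Section Final.
Variable R : realType.

Lemma ae_target_exists (P k0 : nat) (q : nat -> R) : (6 <= P)%N ->
  (forall n, (lev P k0 <= n)%N -> 0 < q n) ->
  (forall k n, (lev P k0 <= n)%N -> (n < lev P k.+1)%N ->
     q n * (1 + ((2 ^ k.+1) ^ (P - 4))%:R^-1) <= q n.+1) ->
  {ae (@lebesgue_measure R), forall x : R, 0 <= x < 1 ->
    exists e : R, 0 <= e < 1 /\ exists n0, forall n (m : int), (n0 <= n)%N ->
      (64 * 2 ^+ P * n%:R)^-1 <= `|q n * x - e - m%:~R|}.
Proof.
move=> P6 q0 qgap; have [k1 steps] := step_ok_eventually P6 q0 qgap.
have QS k : (resolution P q k.+1 = resolution P q k * resolution_ratio P q k)%N by [].
have Q0 k := resolution_gt0 P q k.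
apply: negligibleS (bad_negligible QS Q0 steps) => x /= /not_implyP[x01 nx] n _.
apply: contrapT => ngood; apply: nx.
have stepsK k : ((n + k1).+1 <= k)%N ->
    exists H, step_ok P q (resolution P q) (resolution_ratio P q) k H.
  by move=> hk; apply: steps; apply: leq_trans hk; rewrite ltnW // ltnS leq_addl.
have inh := @not_bad_inhabited R P q _ _ QS Q0 (n + k1).+1 x x01
  (fun d bd => ngood (ex_intro2 _ _ d I bd)).
have [e [e01 far]] := target_exists QS Q0 x01 stepsK inh.
by exists e; split=> //; exists (lev P (n + k1).+1).
Qed.

(** Since [4 / P <= eps], the exponent [1 - eps] may be raised to [1 - 4 / P], for
    which the bound at the end of the block is an exact power of 2. *)
Lemma gap_power (eps : R) P k n : 4 / eps <= P%:R -> 0 < eps -> (6 <= P)%N ->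
  (0 < n)%N -> (n <= lev P k.+1)%N ->
  ((2 ^ k.+1) ^ (P - 4))%:R^-1 <= 1 / n%:R `^ (1 - eps).
Proof.
move=> Peps eps0 P6 n0 nN; have P0 : 0 < P%:R :> R by rewrite ltr0n; lia.
have n1 : 1 <= n%:R :> R by rewrite (ler_nat _ 1).
rewrite mul1r lef_pV2 ?posrE ?powR_gt0 ?ltr0n ?expn_gt0 //.
apply: (@le_trans _ _ (n%:R `^ (1 - 4 / P%:R))).
  apply: ler_powR => //; rewrite lerD2l lerN2 ler_pdivrMr //.
  by move: Peps; rewrite ler_pdivrMr // mulrC.
have P4 : 0 <= 1 - 4 / P%:R :> R.
  by rewrite subr_ge0 ler_pdivrMr // mul1r (ler_nat _ 4); lia.
apply: (@le_trans _ _ ((lev P k.+1)%:R `^ (1 - 4 / P%:R))).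
  by apply: ge0_ler_powR; rewrite ?nnegrE // ler_nat.
have -> : (lev P k.+1)%:R = (2 ^ k.+1)%:R `^ P%:R :> R.
  by rewrite powR_mulrn // -natrX -expnM mulnC.
rewrite -powRrM (_ : P%:R * (1 - 4 / P%:R) = (P - 4)%:R); last first.
  by rewrite natrB; [field; rewrite gt_eqF | lia].
by rewrite powR_mulrn // -natrX.
Qed.

(** A condition on ratios determines the sign of the sequence only up to a global
    choice; for a negative sequence the target is reflected. *)
Lemma ae_target (eps : R) P (q : nat -> R) : 4 / eps <= P%:R -> 0 < eps -> (6 <= P)%N ->
  (\forall n \near \oo, q n.+1 / q n > 1 + 1 / (n%:R `^ (1 - eps))) ->
  {ae (@lebesgue_measure R), forall x : R, 0 <= x < 1 ->
    exists e : R, 0 <= e < 1 /\ exists n0, forall n (m : int), (n0 <= n)%N ->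
      (64 * 2 ^+ P * n%:R)^-1 <= `|q n * x - e - m%:~R|}.
Proof.
move=> Peps eps0 P6 [k0 _ gap].
have k0lev : (k0 <= lev P k0)%N by rewrite ltnW // ltn_lev.
have pos (p : nat -> R) : (forall n, p n.+1 / p n = q n.+1 / q n) -> 0 < p k0 ->
    forall n, (k0 <= n)%N -> 0 < p n.
  move=> pq p0 n /subnKC <-; elim: (n - k0)%N => [|d IH]; first by rewrite addn0.
  have := gap _ (leq_addr d k0); rewrite -pq addnS => h.
  have : 0 < p (k0 + d).+1 / p (k0 + d)%N.
    by apply: lt_trans h; rewrite ltr_wpDr // divr_ge0 // powR_ge0.
  by rewrite pmulr_lgt0 // invr_gt0.
have main (p : nat -> R) : (forall n, p n.+1 / p n = q n.+1 / q n) -> 0 < p k0 ->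
  {ae (@lebesgue_measure R), forall x : R, 0 <= x < 1 ->
    exists e : R, 0 <= e < 1 /\ exists n0, forall n (m : int), (n0 <= n)%N ->
      (64 * 2 ^+ P * n%:R)^-1 <= `|p n * x - e - m%:~R|}.
  move=> pq /(pos _ pq) p0; apply: (@ae_target_exists P k0) => // [n hn|k n hn nk].
    by apply: p0; exact: leq_trans hn.
  have n0 : (0 < n)%N by apply: leq_trans hn; exact: lev_gt0.
  have hpn : 0 < p n by apply: p0; exact: leq_trans hn.
  rewrite mulrC -ler_pdivlMr // pq.
  apply: ltW; apply: le_lt_trans (gap _ (leq_trans k0lev hn)).
  by rewrite lerD2l (gap_power Peps) // ltnW.
have q0 : q k0 != 0.
  apply/eqP => q0; have := gap k0 (leqnn k0); rewrite /= q0 invr0 mulr0.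
  by apply/negP; rewrite -leNgt addr_ge0 // divr_ge0 // powR_ge0.
case: (ltrP 0 (q k0)) => [|qle]; first exact: main.
have qneg : 0 < - q k0 by rewrite oppr_gt0 lt_neqAle q0.
have pq n : - q n.+1 / - q n = q n.+1 / q n by rewrite invrN mulrNN.
apply: negligibleS (main (fun n => - q n) pq qneg).
apply: subsetC => x /= hx x01.
have [e [/andP[e0 e1] [n0 far]]] := hx x01.
have flip n (m m' : int) (e' : R) : e' + e = (m' - m)%:~R -> (n0 <= n)%N ->
    (64 * 2 ^+ P * n%:R)^-1 <= `|q n * x - e' - m%:~R|.
  move=> E /(far _ (- m')); rewrite rmorphB /= in E; rewrite rmorphN /= -normrN.
  by have -> : - (- q n * x - e - - m'%:~R) = q n * x - e' - m%:~R by lra.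
case: (eqVneq e 0) => [ez|enz].
  exists 0; split; first by rewrite lexx ltr01.
  by exists n0 => n m; apply: (flip _ _ m); rewrite ez subrr addr0.
exists (1 - e); split.
  by rewrite subr_ge0 ltW //= ltrBlDr ltrDl lt_neqAle eq_sym enz.
exists n0 => n m; apply: (flip _ _ (m + 1)).
by rewrite subrK addrAC subrr add0r.
Qed.

End Final.

Theorem theorem1p2 (R : realType) (eps : R) (eps_gt0 : 0 < eps) :
  exists c_eps : R, 0 < c_eps /\
    forall q : nat -> R,
      (\forall n \near \oo, q n.+1 / q n > 1 + 1 / (n%:R `^ (1 - eps))) ->
      forall c : R, 0 < c -> c <= c_eps ->
        {ae (@lebesgue_measure R), forall x : R, 0 <= x < 1 ->
          exists delta0 : R, 0 <= delta0 < 1 /\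
            finite_set [set n : nat | (1 <= n)%N /\
              dist_int (q n * x - delta0) < c / n%:R]}.
Proof.
pose P := maxn 6 (Num.truncn (4 / eps)).+1.
have P6 : (6 <= P)%N by exact: leq_maxl.
have Peps : 4 / eps <= P%:R.
  by apply: ltW; apply: lt_le_trans (truncnS_gt _) _; rewrite ler_nat leq_maxr.
exists (64 * 2 ^+ P)^-1; split; first by rewrite invr_gt0 mulr_gt0 ?exprn_gt0.
move=> q gap c c0 cle; apply: negligibleS (ae_target Peps eps_gt0 P6 gap).
apply: subsetC => x /= hx x01; have [e [e01 [n0 far]]] := hx x01.
exists e; split => //; apply: sub_finite_set (finite_II n0) => n /= [n1 close].
rewrite ltnNge; apply/negP => n0n.
have [|_ [m _ <-]] := inf_lt _ close; first by exists `|q n * x - e - 0%:~R|, 0.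
apply/negP; rewrite -leNgt; apply: le_trans (far n m n0n).
rewrite invfM ler_wpM2r ?invr_ge0 //.
Qed.
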